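(* Let $X$ be an independently and identically distributed cluster random finite set on $\mathbb{X}$ with cardinality probability mass function $\rho(\cdot)$ on $\{0,1,2,\dots\}$ and single-object state probability density function $p(\cdot)$ on $\mathbb{X}$, i.e. with multi-object density $f(X)=|X|!\,\rho(|X|)\prod_{\mathbf{x}\in X}p(\mathbf{x})$. Let $\mathcal{S}$ be a field-of-view. Then the number of objects inside $\mathcal{S}$ is distributed according to the probability mass function $$\rho_{\mathcal{S}}(n)=\sum_{m=n}^{\infty}\rho(m)\binom{m}{n}\langle 1_{\mathcal{S}},p\rangle^{n}\,\langle 1-1_{\mathcal{S}},p\rangle^{m-n},\qquad n=0,1,2,\dots$$ where $\binom{m}{n}$ is the binomial coefficient.
   Context: The single-object state space is $\mathbb{X}=\mathbb{X}_s\times\mathbb{X}_v\subseteq\mathbb{R}^{n_x}$, with $\mathbb{X}_s\subseteq\mathbb{R}^{n_s}$ (e.g. position space) and $\mathbb{X}_v$ the remaining state components. A field-of-view is a compact subset $\mathcal{S}$ of $\mathbb{X}_s$. For $\mathbf{x}\in\mathbb{X}$ with $\mathbb{X}_s$-component $\mathbf{s}$, the generalized indicator is $1_{\mathcal{S}}(\mathbf{x})=1$ if $\mathbf{s}\in\mathcal{S}$ and $0$ otherwise. For integrable functions, $\langle f,g\rangle=\int_{\mathbb{X}} f(\mathbf{x})g(\mathbf{x})\,\mathrm{d}\mathbf{x}$. All functions are measurable, and empty products equal $1$. A multi-object density is a function $f$ on finite subsets of $\mathbb{X}$, integrated by the set integral $$\int g(X)\,\delta X=\sum_{m=0}^{\infty}\frac{1}{m!}\int_{\mathbb{X}^m}g(\{\mathbf{x}_1,\dots,\mathbf{x}_m\})\,\mathrm{d}\mathbf{x}_1\cdots\mathrm{d}\mathbf{x}_m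 ,$$ the $m=0$ term being $g(\emptyset)$. The conditional probability that exactly $n$ objects lie inside the field-of-view given $X$ is $$\rho_{\mathcal{S}}(n\mid X)=\sum_{X^n\subseteq X,\ |X^n|=n}\ \prod_{\mathbf{x}\in X^n}1_{\mathcal{S}}(\mathbf{x})\prod_{\mathbf{x}\in X\setminus X^n}(1-1_{\mathcal{S}}(\mathbf{x})),$$ and the field-of-view cardinality distribution is $\rho_{\mathcal{S}}(n)=\int\rho_{\mathcal{S}}(n\mid X)\,f(X)\,\delta X$. *)

(* Defs.v *)
From HB Require Import structures.
From mathcomp Require Import all_boot all_order all_algebra finmap.
From mathcomp Require Import all_classical all_reals all_analysis.
Set Implicit Arguments.
Unset Strict Implicit.
Unset Printing Implicit Defensive.
Import Order.TTheory GRing.Theory Num.Theory.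
Import numFieldNormedType.Exports.

Local Open Scope classical_set_scope.
Local Open Scope ring_scope.

Section product_measure.
Context {d1 d2 : measure_display} {T1 : measurableType d1}
  {T2 : measurableType d2} {R : realType}.
Variables (m1 : {sigma_finite_measure set T1 -> \bar R})
  (m2 : {sigma_finite_measure set T2 -> \bar R}).

(* An alias of m1 \x m2: on m1 \x m2 itself, the library's canonical
   sigma-finite structure only applies when m1 and m2 are subprobabilities. *)
Definition product_measure : set (T1 * T2) -> \bar R := (m1 \x m2)%E.

HB.instance Definition _ := Measure.on product_measure.

Let product_measure_sigma_finite : sigma_finite setT product_measure.
Proof.
have /sigma_finiteP[F [TF ndF Foo]] := sigma_finiteT m1.
have /sigma_finiteP[G [TG ndG Goo]] := sigma_finiteT m2.
exists (fun n => F n `*` G n).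
  rewrite -setXTT TF TG predeqE => -[x y]; split.
    move=> [/= [n _ Fnx] [k _ Gky]]; exists (maxn n k) => //; split.
    - by move: x Fnx; exact/subsetPset/ndF/leq_maxl.
    - by move: y Gky; exact/subsetPset/ndG/leq_maxr.
  by move=> [n _ []/= ? ?]; split; exists n.
move=> k; have [? ?] := Foo k; have [? ?] := Goo k.
split; first exact: measurableX.
by rewrite /product_measure product_measure1E// lte_mul_pinfty// ge0_fin_numE.
Qed.

HB.instance Definition _ := Measure_isSigmaFinite.Build _ _ _ product_measure
  product_measure_sigma_finite.

End product_measure.

Section power_measure.
Context {d : measure_display} {T : measurableType d} {R : realType}.
Variable mu : {sigma_finite_measure set T -> \bar R}.

Definition tuple_cons n (z : T * n.-tuple T) : n.+1.-tuple T :=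
  [tuple of z.1 :: z.2].

Lemma measurable_tuple_cons n : measurable_fun [set: T * n.-tuple T]
  (@tuple_cons n).
Proof. exact: measurable_cons. Qed.

Section step.
Variables (n : nat) (m : {sigma_finite_measure set (n.-tuple T) -> \bar R}).

Definition cons_measure : set (n.+1.-tuple T) -> \bar R :=
  pushforward (product_measure mu m) (@tuple_cons n).

Let cons_measure0 : cons_measure set0 = 0%E.
Proof. by rewrite /cons_measure /pushforward preimage_set0 measure0. Qed.

Let cons_measure_ge0 A : (0 <= cons_measure A)%E.
Proof. by rewrite /cons_measure /pushforward measure_ge0. Qed.

Let cons_measure_sigma_additive : semi_sigma_additive cons_measure.
Proof.
move=> F mF tF mUF; have mc := @measurable_tuple_cons n.
rewrite /cons_measure /pushforward preimage_bigcup.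
apply: measure_semi_sigma_additive.
- by move=> i; rewrite -[X in measurable X]setTI; exact: mc.
- apply/trivIsetP => /= i j _ _ ij; rewrite -preimage_setI.
  by move/trivIsetP : tF => /(_ _ _ _ _ ij) ->//; rewrite preimage_set0.
- by rewrite -preimage_bigcup -[X in measurable X]setTI; exact: mc.
Qed.

HB.instance Definition _ := isMeasure.Build _ _ _ cons_measure
  cons_measure0 cons_measure_ge0 cons_measure_sigma_additive.

Let cons_measure_sigma_finite : sigma_finite setT cons_measure.
Proof.
have [F TF Foo] := sigma_finiteT (product_measure mu m).
pose uncons (t : n.+1.-tuple T) := (thead t, [tuple of behead t]).
have consK : cancel (@tuple_cons n) uncons.
  by case=> x s; congr pair; apply: val_inj.
have unconsK : cancel uncons (@tuple_cons n).
  by move=> t; rewrite /tuple_cons/= [RHS]tuple_eta.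
have muncons : measurable_fun setT uncons.
  apply/measurable_fun_pairP; split.
    exact: (measurable_tnth ord0).
  exact: measurable_behead.
exists (fun k => uncons @^-1` F k) => [|k].
  by rewrite -preimage_bigcup -TF preimage_setT.
have [mF Fk] := Foo k; split; first by rewrite -[X in measurable X]setTI; exact: muncons.
rewrite /cons_measure /pushforward -comp_preimage.
by rewrite (_ : uncons \o _ = id) ?preimage_id//; apply/funext => z; exact: consK.
Qed.

HB.instance Definition _ := Measure_isSigmaFinite.Build _ _ _ cons_measure
  cons_measure_sigma_finite.

End step.

(* The n-fold product mu \x ... \x mu; the 0-fold product is the unit mass at
   the empty tuple. *)
Fixpoint power_measure n : {sigma_finite_measure set (n.-tuple T) -> \bar R} :=
  if n is n'.+1 then cons_measure (power_measure n')
  else \d_([tuple] : 0.-tuple T).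

(* Terms with m > 0 evaluate g at the set of entries of the m-tuple t, which has
   fewer than m elements when entries of t coincide. *)
Definition set_integral (D : set T) (g : {fset T} -> R) : \bar R :=
  (\sum_(0 <= m <oo) ((m`!%:R^-1)%:E *
     \int[power_measure m]_(t in [set t | forall i, D (tnth t i)])
       (g [fset x in tval t]%fset)%:E))%E.

(* <f, g> over the state space D *)
Definition inner (D : set T) (f g : T -> R) : R :=
  \int[mu]_(x in D) (f x * g x).

Definition is_pdf (D : set T) (p : T -> R) : Prop :=
  [/\ measurable_fun D p, forall x, D x -> 0 <= p x
    & (\int[mu]_(x in D) (p x)%:E = 1)%E].

End power_measure.

Definition is_pmf {R : realType} (q : nat -> \bar R) : Prop :=
  (forall n, 0 <= q n)%E /\ (\sum_(0 <= n <oo) q n = 1)%E.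

Definition iid_cluster_density {T : choiceType} {R : realType}
    (rho : nat -> R) (p : T -> R) (X : {fset T}) : R :=
  (#|` X|)`!%:R * rho #|` X| * \prod_(x <- X) p x.

(* R^n is the type of n-tuples of reals, with the product (Borel)
   sigma-algebra. *)
Notation euclidean R n := (n.-tuple (measurableTypeR R)).

(* R^(ns + nv), split into the ns components seen by the field-of-view and the
   nv remaining ones. *)
Notation state R ns nv := (euclidean R ns * euclidean R nv)%type.

Section field_of_view.
Context {R : realType} {ns nv : nat}.

Definition state_measure : {sigma_finite_measure set (state R ns nv) -> \bar R} :=
  product_measure (power_measure (@lebesgue_measure R) ns)
    (power_measure (@lebesgue_measure R) nv).

(* Tuples carry no topology in the library, so compactness is that of the
   corresponding set of row vectors. *)
Definition is_field_of_view (Xs S : set (euclidean R ns)) : Prop :=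
  S `<=` Xs /\ compact [set \row_i (tnth s i : R) | s in S].

Definition fov_indic (S : set (euclidean R ns)) (x : state R ns nv) : R :=
  \1_S x.1.

Definition fov_cond_card (S : set (euclidean R ns)) (n : nat)
    (X : {fset state R ns nv}) : R :=
  \sum_(Y <- fpowerset X | #|` Y| == n)
    (\prod_(x <- Y) fov_indic S x) *
    (\prod_(x <- (X `\` Y)%fset) (1 - fov_indic S x)).

Definition fov_card (D : set (state R ns nv)) (f : {fset state R ns nv} -> R)
    (S : set (euclidean R ns)) (n : nat) : \bar R :=
  set_integral state_measure D (fun X => fov_cond_card S n X * f X).

End field_of_view.

(* Main.v *)
(** When the entries of [t] are distinct, the integrand of the m-th term is
    [m! rho(m)] times the indicator that exactly [n] entries lie in the
    field-of-view, times the product of the [p t_i]. Its integral over m-tuples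
    is found by induction on [m], integrating out one entry at a time (Tonelli).
    Tuples with a repeated entry form a null set, because Lebesgue measure on
    a space of positive dimension has no atoms; and a compact field-of-view is
    Borel. The result is a probability mass function by exchanging the two
    series and applying the binomial theorem to [<1_S, p> + <1 - 1_S, p> = 1]. *)

Require Import Defs.
From mathcomp Require Import all_boot all_order all_algebra finmap ring.
From mathcomp Require Import all_classical all_reals all_analysis.
From mathcomp Require Import measurable_realfun.
Import Order.TTheory GRing.Theory Num.Theory.
Import numFieldNormedType.Exports.
Local Open Scope classical_set_scope.
Local Open Scope ring_scope.

(** * Integrals of functions known only off a null set *)

Section null_sets.
Context {d : measure_display} {T : measurableType d} {R : realType}.
Variable mu : {measure set T -> \bar R}.

(** The integral of a nonnegative function is a supremum over the simple functions below it, and a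
    larger function has more of them. *)
Lemma ge0_le_integral_nonmeasurable (f g : T -> \bar R) :
  (forall x, 0 <= f x)%E -> (forall x, f x <= g x)%E ->
  (\int[mu]_x f x <= \int[mu]_x g x)%E.
Proof.
move=> f0 fg; rewrite !ge0_integralTE//; last first.
  by move=> x; exact: le_trans (f0 x) (fg x).
apply: le_ereal_sup => _ [h /= hf <-]; exists h => //= x.
exact: le_trans (hf x) (fg x).
Qed.

(* [f] may be non-measurable: it is squeezed between [g] cut to 0 on [N] and
   [g] raised to +oo on [N]. *)
Lemma ge0_eq_integral_null (N : set T) (f g : T -> \bar R) :
  measurable N -> mu N = 0%E -> measurable_fun setT g ->
  (forall x, 0 <= f x)%E -> (forall x, 0 <= g x)%E ->
  (forall x, ~ N x -> f x = g x) ->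
  (\int[mu]_x f x = \int[mu]_x g x)%E.
Proof.
move=> mN N0 mg f0 g0 fg.
have mNC : measurable (~` N) by exact: measurableC.
apply/eqP; rewrite eq_le; apply/andP; split.
  pose G x := (g x + ((cst +oo%E) \_ N) x)%E.
  have r0 x : (0 <= ((cst +oo) \_ N) x :> \bar R)%E.
    by rewrite patchE; case: ifP => //= _; rewrite leey.
  have mG : measurable_fun setT G.
    apply: emeasurable_funD => //.
    by apply/(measurable_restrictT _ mN); exact: measurable_cst.
  apply: (@le_trans _ _ (\int[mu]_x G x)%E).
    apply: ge0_le_integral_nonmeasurable => // x; rewrite /G.
    have [Nx|Nx] := pselect (N x).
      rewrite patchE mem_set//= addey ?leey//.
      by rewrite gt_eqF// (lt_le_trans _ (g0 x))// ltNy0.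
    by rewrite fg// patchE memNset//= adde0.
  rewrite (ge0_negligible_integral mN _ mG)//; last first.
    by move=> x _; rewrite adde_ge0.
  rewrite (ge0_negligible_integral mN _ mg)//.
  rewrite le_eqVlt; apply/orP; left; apply/eqP.
  apply: eq_integral => x; rewrite inE => -[_ Nx].
  by rewrite /G patchE memNset//= adde0.
rewrite (ge0_negligible_integral mN _ mg)// setTD integral_mkcond.
apply: ge0_le_integral_nonmeasurable => x; rewrite patchE.
  by case: ifP.
by case: ifPn => // /set_mem Nx; rewrite fg.
Qed.

End null_sets.

(** * Integration over tuples, one entry at a time *)

Section power_measure_lemmas.
Context {d : measure_display} {T : measurableType d} {R : realType}.
Variable mu : {sigma_finite_measure set T -> \bar R}.

Lemma behead_tuple_cons m x (t : m.-tuple T) :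
  [tuple of behead (tuple_cons (x, t))] = t.
Proof. exact: val_inj. Qed.

(** The measure on [m.+1]-tuples is the image of a product measure under [tuple_cons], so a change
    of variables reduces the claim to Tonelli. *)
Lemma integral_power_measureS m (f : m.+1.-tuple T -> \bar R) :
  measurable_fun setT f -> (forall t, 0 <= f t)%E ->
  (\int[power_measure mu m.+1]_t f t =
   \int[mu]_x \int[power_measure mu m]_t f (tuple_cons (x, t)))%E.
Proof.
move=> mf f0; have mc := @measurable_tuple_cons d T m.
transitivity (\int[pushforward (product_measure mu (power_measure mu m))
   (@tuple_cons d T m)]_t f t)%E; first by [].
rewrite ge0_integral_pushforward// preimage_setT.
exact: (fubini_tonelli1 (f \o @tuple_cons d T m) (measurableT_comp mf mc)
  (fun z => f0 (tuple_cons z))).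
Qed.

Lemma measurable_head_mul_behead m (u : T -> R) (g : m.-tuple T -> R) :
  measurable_fun setT u -> measurable_fun setT g ->
  measurable_fun setT (fun t : m.+1.-tuple T =>
    u (thead t) * g [tuple of behead t]).
Proof.
move=> mu_ mg; apply: measurable_funM.
  by apply: measurableT_comp => //; exact: (measurable_tnth ord0).
by apply: measurableT_comp => //; exact: measurable_behead.
Qed.

Lemma integral_power_measure_mul m (u : T -> R) (g : m.-tuple T -> R) :
  measurable_fun setT u -> measurable_fun setT g ->
  (forall x, 0 <= u x) -> (forall t, 0 <= g t) ->
  (\int[power_measure mu m.+1]_t (u (thead t) * g [tuple of behead t])%:E =
   (\int[mu]_x (u x)%:E) * \int[power_measure mu m]_t (g t)%:E)%E.
Proof.
move=> mu_ mg u0 g0; rewrite integral_power_measureS.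
- transitivity (\int[mu]_x ((u x)%:E * \int[power_measure mu m]_t (g t)%:E))%E.
    apply: eq_integral => x _; rewrite -ge0_integralZl//; last 3 first.
    + exact/measurable_EFinP.
    + by move=> t _; rewrite lee_fin.
    + by rewrite lee_fin.
    by apply: eq_integral => t _; rewrite behead_tuple_cons EFinM.
  rewrite ge0_integralZr//.
  - exact/measurable_EFinP.
  - by move=> x _; rewrite lee_fin.
  - by apply: integral_ge0 => t _; rewrite lee_fin.
- by apply/measurable_EFinP; exact: measurable_head_mul_behead.
- by move=> t; rewrite lee_fin mulr_ge0.
Qed.

(** The count is a finite sum of measurable indicators, and the test against [n] is the indicator of
    a point of the reals. *)
Lemma measurable_count_eq (A : set T) m n : measurable A ->
  measurable_fun setT
    (fun t : m.-tuple T => (count (mem A) t == n)%:R : R).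
Proof.
move=> mA.
rewrite (_ : (fun _ => _) = \1_[set (n%:R : R)] \o
    (fun t : m.-tuple T => \sum_(i < m) (\1_A (tnth t i) : R))).
  apply: measurableT_comp; first exact: measurable_indic.
  apply: measurable_sum => i; apply: measurableT_comp; last exact: measurable_tnth.
  exact: measurable_indic.
apply/funext => t /=; rewrite indicE.
rewrite (_ : \sum_(i < m) _ = (count (mem A) t)%:R).
  congr (nat_of_bool _)%:R; apply/eqP/idP => [->|]; first by rewrite inE.
  by rewrite inE/= => /eqP; rewrite eqr_nat => /eqP.
rewrite -sum1_count big_tuple natr_sum [RHS]big_mkcond/=.
by apply: eq_bigr => i _; rewrite indicE; case: ifP.
Qed.

Lemma measurable_prod_tuple (q : T -> R) m : measurable_fun setT q ->
  measurable_fun setT (fun t : m.-tuple T => \prod_(x <- t) q x).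
Proof.
move=> mq; under eq_fun do rewrite big_tuple.
by apply: measurable_prod => i _; apply: measurableT_comp => //; exact: measurable_tnth.
Qed.

(* Splitting off the first entry turns Pascal's rule for the binomial
   coefficients into the recursion satisfied by the integrals. *)
Lemma integral_power_measure_count (A : set T) (q : T -> R) (a b : R) m n :
  measurable A -> measurable_fun setT q -> (forall x, 0 <= q x) ->
  (\int[mu]_x (\1_A x * q x)%:E = a%:E)%E ->
  (\int[mu]_x ((1 - \1_A x) * q x)%:E = b%:E)%E ->
  (\int[power_measure mu m]_t
     ((count (mem A) t == n)%:R * \prod_(x <- t) q x)%:E =
   ('C(m, n)%:R * a ^+ n * b ^+ (m - n))%:E)%E.
Proof.
move=> mA mq q0 ia ib.
have mI : measurable_fun setT (\1_A : T -> R) by exact: measurable_indic.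
pose g m n (t : m.-tuple T) : R :=
  (count (mem A) t == n)%:R * \prod_(x <- t) q x.
have mg k l : measurable_fun setT (g k l).
  apply: measurable_funM; first exact: measurable_count_eq.
  exact: measurable_prod_tuple.
have g0 k l t : 0 <= g k l t by rewrite mulr_ge0// prodr_ge0.
(* [u] and [v] weigh a head inside and outside [A]; their integrals are [a] and [b]. *)
pose u x : R := \1_A x * q x; pose v x : R := (1 - \1_A x) * q x.
have mu_ : measurable_fun setT u by exact: measurable_funM.
have mv : measurable_fun setT v.
  by apply: measurable_funM => //; apply: measurable_funB.
have u0 x : 0 <= u x by rewrite mulr_ge0.
have v0 x : 0 <= v x by rewrite mulr_ge0// indicE; case: (_ \in _); rewrite ?subrr ?subr0.
elim: m n => [|m IH] n.
  rewrite integral_dirac//; last by apply/measurable_EFinP; exact: (mg 0 n).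
  rewrite diracT mul1e /= big_nil mulr1.
  by case: n => [|n]; rewrite ?bin0 ?bin0n ?eqxx ?mul0r//= ?expr0 ?mulr1.
(* The head adds one to the count exactly when it lies in [A]; a count of 0 forces it outside. *)
have gS k (t : m.+1.-tuple T) : g m.+1 k t =
    (if k is l.+1 then u (thead t) * g m l [tuple of behead t] else 0) +
    v (thead t) * g m k [tuple of behead t].
  case/tupleP: t => x t; have -> : [tuple of behead [tuple of x :: t]] = t.
    exact: val_inj.
  rewrite theadE /u /v /g /= big_cons indicE.
  case: k => [|k]; case: (x \in A) => /=;
    rewrite !(subrr, subr0, mul0r, mul1r, add0r, addr0, add0n, add1n) ?eqSS//;
    exact: mulrCA.
case: n => [|n].
  transitivity (\int[power_measure mu m.+1]_t
      (v (thead t) * g m 0 [tuple of behead t])%:E)%E.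
    by apply: eq_integral => t _; rewrite -[X in X%:E]/(g _ _ _) gS add0r.
  rewrite integral_power_measure_mul// ib IH -EFinM; congr EFin.
  by rewrite !bin0 !expr0 !subn0 !mul1r exprS.
transitivity (\int[power_measure mu m.+1]_t
    ((u (thead t) * g m n [tuple of behead t])%:E +
     (v (thead t) * g m n.+1 [tuple of behead t])%:E))%E.
  by apply: eq_integral => t _; rewrite -[X in X%:E]/(g _ _ _) gS EFinD.
rewrite ge0_integralD//; last 4 first.
- by move=> t _; rewrite lee_fin mulr_ge0.
- by apply/measurable_EFinP; exact: measurable_head_mul_behead.
- by move=> t _; rewrite lee_fin mulr_ge0.
- by apply/measurable_EFinP; exact: measurable_head_mul_behead.
rewrite !integral_power_measure_mul// ia ib !IH -!EFinM -EFinD; congr EFin.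
rewrite binS natrD !mulrDl addrC; congr (_ + _).
  (* Subtraction is truncated: for [m <= n] the exponents do not match, but ['C(m, n.+1)] vanishes;
     otherwise [m - n] is the successor of [m - n.+1]. *)
  have [mn|nm] := leqP m n; first by rewrite bin_small// !mul0r mulr0.
  by rewrite subSS -(subnSK nm) [b ^+ _.+1]exprS; ring.
by rewrite subSS exprS; ring.
Qed.

End power_measure_lemmas.

(** * Measurability of the diagonal *)

Section diagonal.

(** This property can fail in a general measurable space. It makes coincidence sets, such as the
    tuples with a repeated entry, measurable. *)
Definition measurable_diagonal {d} (T : measurableType d) :=
  measurable [set z : T * T | z.1 = z.2].

Lemma measurable_diagonal_real (R : realType) :
  measurable_diagonal (measurableTypeR R).
Proof.
rewrite /measurable_diagonal.
(* The diagonal is the preimage of [true] under the boolean equality of the two projections. *)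
have := @measurable_fun_eqr _ _ R setT _ _
  (@measurable_fst _ _ (measurableTypeR R) (measurableTypeR R))
  (@measurable_snd _ _ (measurableTypeR R) (measurableTypeR R)).
move=> /(_ measurableT [set true]); rewrite setTI => /(_ I).
by congr measurable; apply/seteqP; split => z /= /eqP.
Qed.

(** The coincidence set is the preimage of the diagonal under the pair [(f, g)]. *)
Lemma measurable_eq_fun d d' (U : measurableType d) (T : measurableType d')
    (f g : U -> T) : measurable_diagonal T ->
  measurable_fun setT f -> measurable_fun setT g ->
  measurable [set x | f x = g x].
Proof.
move=> mT mf mg.
have mfg : measurable_fun setT (fun x => (f x, g x)).
  exact: measurable_fun_pair.
by have := mfg measurableT _ mT; rewrite setTI.
Qed.

Lemma measurable_diagonal_tuple d (T : measurableType d) n :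
  measurable_diagonal T -> measurable_diagonal (n.-tuple T).
Proof.
move=> mT; rewrite /measurable_diagonal.
rewrite (_ : [set _ | _] =
    \bigcap_(i in [set: 'I_n]) [set z : n.-tuple T * n.-tuple T |
      tnth z.1 i = tnth z.2 i]).
  apply: fin_bigcap_measurable => // i _; apply: measurable_eq_fun => //.
  - exact: (measurableT_comp (measurable_tnth i) measurable_fst).
  - exact: (measurableT_comp (measurable_tnth i) measurable_snd).
apply/seteqP; split => [[z w] /= -> //|z zi].
by apply: eq_from_tnth => i; exact: zi.
Qed.

Lemma measurable_diagonal_prod d d' (T : measurableType d)
    (U : measurableType d') :
  measurable_diagonal T -> measurable_diagonal U ->
  measurable_diagonal (T * U)%type.
Proof.
move=> mT mU; rewrite /measurable_diagonal.
rewrite (_ : [set _ | _] = [set z : (T * U) * (T * U) | z.1.1 = z.2.1] `&`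
                           [set z : (T * U) * (T * U) | z.1.2 = z.2.2]).
  by apply: measurableI; apply: measurable_eq_fun => //; exact: measurableT_comp.
apply/seteqP; split => [[z w] /= -> //|[[x y] [x' y']] /= [-> ->]//].
Qed.

End diagonal.

(** * Tuples with a repeated entry are null for an atomless measure *)

Section atomless.
Context {d : measure_display} {T : measurableType d} {R : realType}.
Variable mu : {sigma_finite_measure set T -> \bar R}.
Hypothesis mT : measurable_diagonal T.
Hypothesis mu1 : forall x, mu [set x] = 0%E.

(** A singleton is where the identity agrees with a constant map. *)
Lemma measurable_singleton (x : T) : measurable [set x].
Proof. by apply: measurable_eq_fun. Qed.

Lemma atomless_seq (s : seq T) : measurable [set` s] /\ mu [set` s] = 0%E.
Proof.
elim: s => [|x s [ms s0]]; first by rewrite set_nil measure0.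
have mx := measurable_singleton x.
have -> : [set` x :: s] = [set x] `|` [set` s].
  apply/seteqP; split => y /=; rewrite inE; first by case/predU1P; [left|right].
  by case=> [->|->]; rewrite ?eqxx ?orbT.
by split; [exact: measurableU|exact: (null_set_setU mx ms (mu1 x) s0)].
Qed.

Lemma measurable_not_uniq n : measurable [set t : n.-tuple T | ~~ uniq t].
Proof.
rewrite (_ : [set _ | _] = \bigcup_(ij in [set ij : 'I_n * 'I_n | ij.1 != ij.2])
    [set t : n.-tuple T | tnth t ij.1 = tnth t ij.2]).
  apply: fin_bigcup_measurable => // ij _.
  by apply: measurable_eq_fun => //; exact: measurable_tnth.
apply/seteqP; split => [t /=|t [[i j] /= ij tij]]; last first.
  by apply: contra ij => /tuple_uniqP/(_ _ _ tij) ->.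
apply: contraNP => H; apply/tuple_uniqP => i j tij.
by apply/eqP/negPn/negP => ij; apply: H; exists (i, j).
Qed.

(** Induction on [n]: in a tuple with a repetition, either the head occurs in the tail, which is the
    event [M], or the tail already has a repetition. *)
Lemma power_measure_not_uniq n :
  power_measure mu n [set t : n.-tuple T | ~~ uniq t] = 0%E.
Proof.
elim: n => [|n IH].
  by rewrite (_ : [set _ | _] = set0) ?measure0//; apply/seteqP; split => // t; rewrite /= tuple0.
pose M := [set z : T * n.-tuple T | z.1 \in z.2].
have -> : power_measure mu n.+1 [set t | ~~ uniq t] =
    product_measure mu (power_measure mu n)
      (M `|` setT `*` [set t : n.-tuple T | ~~ uniq t]).
  rewrite /= /cons_measure /pushforward; congr (product_measure _ _ _).
  apply/seteqP; split => -[x t] /=; rewrite negb_and negbK.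
    by move=> /orP[]; [left|right].
  by move=> [xt|[_ ->]]; rewrite ?orbT//; apply/orP; left.
have mM : measurable M.
  rewrite (_ : M = \bigcup_(i in [set: 'I_n])
      [set z : T * n.-tuple T | z.1 = tnth z.2 i]).
    apply: fin_bigcup_measurable => // i _; apply: measurable_eq_fun => //.
    exact: (measurableT_comp (measurable_tnth i) measurable_snd).
  apply/seteqP; split => [[x t] /tnthP[i xi]|[x t] [i _ xi]].
    by exists i.
  by apply/tnthP; exists i.
apply: null_set_setU => //.
- by apply: measurableX => //; exact: measurable_not_uniq.
- change ((mu \x power_measure mu n)%E M = 0%E).
  (* By uniqueness of the product measure, [M] can be measured by fixing the tail [t] first; the
     section is then the finite set of entries of [t], which is null. *)
  rewrite (@product_measure_unique _ _ _ _ _ mu (power_measure mu n)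
    (mu \x^ power_measure mu n)%E)//; last first.
    by move=> A B mA mB; exact: product_measure2E.
  apply: integral0_eq => t _ /=.
  rewrite (_ : ysection M t = [set` tval t]); first exact: (atomless_seq t).2.
  by apply/seteqP; split => x; rewrite /ysection /M /= inE.
- change ((mu \x power_measure mu n)%E ([set: T] `*` [set t : n.-tuple T | ~~ uniq t]) = 0%E).
  by rewrite product_measure1E ?IH ?mule0//; exact: measurable_not_uniq.
Qed.

End atomless.

(** * Points are null for the state measure *)

Lemma product_measure_set1 d1 d2 (T1 : measurableType d1)
    (T2 : measurableType d2) (R : realType)
    (m1 : {sigma_finite_measure set T1 -> \bar R})
    (m2 : {sigma_finite_measure set T2 -> \bar R}) (x : T1 * T2) :
  measurable [set x.1] -> measurable [set x.2] ->
  product_measure m1 m2 [set x] = (m1 [set x.1] * m2 [set x.2])%E.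
Proof.
move=> mx1 mx2; rewrite -product_measure1E//; congr (product_measure _ _ _).
by case: x {mx1 mx2} => x y; apply/seteqP; split => [z -> //|[z w] [/= -> ->]].
Qed.

(** A point is the product of its head and its tail, and the head is already Lebesgue-null. *)
Lemma power_lebesgue_measure_set1 (R : realType) n (t : euclidean R n) :
  (0 < n)%N -> power_measure (@lebesgue_measure R) n [set t] = 0%E.
Proof.
case: n t => // n t _; have mR := measurable_diagonal_real R.
case/tupleP: t => x t.
transitivity (product_measure (@lebesgue_measure R)
    (power_measure (@lebesgue_measure R) n) [set (x, t)]).
  rewrite /= /cons_measure /pushforward; congr (product_measure _ _ _).
  apply/seteqP; split => [[y u] /=|[y u] [-> ->] /=].
    by move=> /(congr1 val) [-> /val_inj ->].
  exact: val_inj.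
have mx : measurable [set x] by exact: measurable_singleton.
have mt : measurable [set t].
  by apply: measurable_singleton; exact: measurable_diagonal_tuple.
rewrite product_measure_set1//.
by rewrite [X in (X * _)%E](_ : _ = 0%E) ?mul0e//; exact: lebesgue_measure_set1.
Qed.

Lemma measurable_diagonal_state (R : realType) ns nv :
  measurable_diagonal (state R ns nv).
Proof.
by apply: measurable_diagonal_prod; apply: measurable_diagonal_tuple;
  exact: measurable_diagonal_real.
Qed.

(** At least one factor has positive dimension and contributes a zero. In total dimension 0 the only
    point would have mass 1. *)
Lemma state_measure_set1 (R : realType) ns nv (x : state R ns nv) :
  (0 < ns + nv)%N -> state_measure [set x] = 0%E.
Proof.
have mt n (t : euclidean R n) : measurable [set t].
  apply: measurable_singleton; apply: measurable_diagonal_tuple.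
  exact: measurable_diagonal_real.
rewrite addn_gt0 => n0.
transitivity (power_measure (@lebesgue_measure R) ns [set x.1] *
              power_measure (@lebesgue_measure R) nv [set x.2])%E.
  exact: product_measure_set1 (mt _ _) (mt _ _).
case/orP: n0 => n0.
  by rewrite power_lebesgue_measure_set1// mul0e.
by rewrite [X in (_ * X)%E]power_lebesgue_measure_set1// mule0.
Qed.

(** * Fields-of-view are Borel *)

(** An open set is the countable union of the rational boxes it contains, and a box is a finite
    intersection of coordinate preimages. This links the topology of row vectors to the
    sigma-algebra of tuples. *)
Lemma measurable_open_rows (R : realType) n (U : set 'rV[R]_n) :
  open U -> measurable [set t : euclidean R n | U (\row_i (tnth t i : R))].
Proof.
move=> oU.
pose box (lr : {ffun 'I_n -> rat} * {ffun 'I_n -> rat}) :=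
  [set t : euclidean R n |
    forall i, (tnth t i : R) \in `]ratr (lr.1 i), ratr (lr.2 i)[].
(* Boxes not contained in [U] are replaced by the empty set, so that the union runs over a whole
   countable type. *)
rewrite (_ : [set _ | _] = \bigcup_lr
    (if pselect (box lr `<=` [set t | U (\row_i (tnth t i : R))])
     then box lr else set0)).
  apply: countable_bigcupT_measurable => [|lr]; first exact: countableP.
  case: pselect => ? /=; last exact: measurable0.
  rewrite (_ : box lr = \bigcap_(i in [set: 'I_n]) ((@tnth n (measurableTypeR R))^~ i @^-1`
      [set` `]ratr (lr.1 i) : R, ratr (lr.2 i)[])).
    apply: fin_bigcap_measurable => // i _.
    rewrite -[X in measurable X]setTI.
    by apply: measurable_tnth => //; exact: measurable_itv.
  by apply/seteqP; split => [t H i _|t H i]; [exact: H|exact: (H i I)].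
apply/seteqP; split => [t /= Ut|t [lr _]]; last first.
  by case: pselect => //= sub tlr; exact: sub.
have /nbhs_ballP[e /= e0 eU] : nbhs (\row_i (tnth t i : R)) U.
  exact: open_nbhs_nbhs.
(* Rational endpoints are chosen within [e] on either side of each coordinate, so the box contains
   [t] and stays in the ball of radius [e]. *)
have /fin_all_exists[l lP] : forall i, exists q : rat,
    ratr q \in `](tnth t i : R) - e, (tnth t i : R)[.
  by move=> i; apply: rat_in_itvoo; rewrite ltrBlDr ltrDl.
have /fin_all_exists[r rP] : forall i, exists q : rat,
    ratr q \in `](tnth t i : R), (tnth t i : R) + e[.
  by move=> i; apply: rat_in_itvoo; rewrite ltrDl.
exists (finfun l, finfun r) => //.
case: pselect => /= [_ i|].
  have := lP i; have := rP i; rewrite !ffunE !in_itv/=.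
  by move=> /andP[-> _] /andP[_ ->].
apply; move=> s sP; apply: eU; split=> // i j; rewrite !mxE /ball /=.
have := lP j; have := rP j; have := sP j; rewrite !ffunE !in_itv/=.
move=> /andP[s1 s2] /andP[r1 r2] /andP[l1 l2].
rewrite ltr_distlC.
by rewrite (lt_trans l1 s1) (lt_trans s2 r2).
Qed.

(** A compact set of row vectors is closed, and the complement of [S] is the preimage of its open
    complement. *)
Lemma measurable_field_of_view (R : realType) ns (Xs S : set (euclidean R ns)) :
  is_field_of_view Xs S -> measurable S.
Proof.
move=> [_ cS].
have oC := closed_openC (compact_closed (@norm_hausdorff _ _) cS).
rewrite -[S]setCK; apply: measurableC.
rewrite (_ : ~` S = [set t : euclidean R ns |
   (~` [set \row_i (tnth s i : R) | s in S]) (\row_i (tnth t i : R))]).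
  exact: measurable_open_rows.
(* Equality of the two sets rests on the injectivity of the map from tuples to rows. *)
apply/seteqP; split => t St /=; last by move=> ?; apply: St; exists t.
move=> [s Ss st]; apply: St; rewrite (_ : t = s)//.
apply: eq_from_tnth => i; have /rowP/(_ i) := st.
by rewrite !mxE.
Qed.

(** * Counting the objects inside the field-of-view *)

Section cardinality.
Context {R : realType} {ns nv : nat}.

(** Only the subset [Z] of points of [X] seen by [S] gives a nonzero product, and that product is 1;
    the sum therefore tests whether [Z] has [n] elements. *)
Lemma fov_cond_cardE (S : set (euclidean R ns)) n (X : {fset state R ns nv}) :
  fov_cond_card S n X = (count (mem (fst @^-1` S)) X == n)%:R.
Proof.
pose Z := [fset x in X | x \in fst @^-1` S]%fset.
have inZ x : x \in Z = (x \in X) && (x \in fst @^-1` S) by rewrite !inE.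
have ZE : count (mem (fst @^-1` S)) X = #|` Z|.
  rewrite -size_filter; apply/perm_size/uniq_perm.
  - exact/filter_uniq/fset_uniq.
  - exact: fset_uniq.
  - by move=> x; rewrite mem_filter inZ andbC.
have indE (x : state R ns nv) : fov_indic S x = (x \in fst @^-1` S)%:R.
  by rewrite /fov_indic indicE; congr (nat_of_bool _)%:R; apply/idP/idP; rewrite !inE.
have termE Y : Y \in fpowerset X ->
    (\prod_(x <- Y) fov_indic S x) *
    (\prod_(x <- (X `\` Y)%fset) (1 - fov_indic S x)) = (Y == Z)%:R.
  rewrite fpowersetE => /fsubsetP YX; have [->|/eqP YZ] := eqVneq Y Z.
    rewrite !big_seq !big1 ?mulr1// => x; last by rewrite inZ indE => /andP[_ ->].
    rewrite in_fsetD inZ indE => /andP[+ xX]; rewrite xX /= => /negbTE ->.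
    exact: subr0.
  (* If both products were nonzero, [Y] would lie inside the field-of-view and the rest of [X]
     outside it, forcing [Y = Z]. *)
  apply/eqP; rewrite mulf_eq0; apply/negPn/negP; rewrite negb_or.
  rewrite !prodf_seq_neq0 => /andP[/allP YS /allP XYS]; apply: YZ.
  apply/fsetP => x; rewrite inZ; apply/idP/andP => [xY|[xX xS]].
    split; first exact: YX.
    by have := YS _ xY; rewrite indE /=; case: (x \in _); rewrite ?eqxx.
  apply/negPn/negP => xY.
  by have := XYS x; rewrite in_fsetD xY xX indE xS subrr eqxx => /(_ isT).
rewrite /fov_cond_card big_mkcond big_seq.
under eq_bigr => Y YX do rewrite termE//.
rewrite -big_seq (bigD1_seq Z)/=; last 2 first.
- by rewrite fpowersetE; apply/fsubsetP => x; rewrite inZ => /andP[].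
- exact: fset_uniq.
rewrite big1 ?addr0 ?eqxx ?ZE; first by case: ifP.
by move=> Y /negbTE ->; case: ifP.
Qed.

(** With distinct entries, the elements of [X] are a permutation of [t], so cardinality, count and
    product carry over. *)
Lemma fset_tuple_fov_density (rho : nat -> R) (p : state R ns nv -> R)
    (S : set (euclidean R ns)) m n (t : m.-tuple (state R ns nv)) :
  uniq t ->
  let X := [fset x in tval t]%fset in
  fov_cond_card S n X * iid_cluster_density rho p X =
  m`!%:R * rho m *
    ((count (mem (fst @^-1` S)) t == n)%:R * \prod_(x <- t) p x).
Proof.
move=> ut X; have Xt : perm_eq X t.
  by apply: uniq_perm => //= x; rewrite inE.
have cX : #|` X| = m by rewrite (perm_size Xt) size_tuple.
rewrite fov_cond_cardE /iid_cluster_density cX (perm_big _ Xt)/=.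
by rewrite (permP Xt) mulrCA.
Qed.

End cardinality.

(** * Inner products with a density extended by 0 outside [D] *)

Section inner_pdf.
Context {d : measure_display} {T : measurableType d} {R : realType}.
Variables (mu : {sigma_finite_measure set T -> \bar R}) (D : set T) (p : T -> R).
Hypotheses (mD : measurable D) (hp : is_pdf mu D p).

Lemma measurable_pdf_restrict : measurable_fun setT (p \_ D).
Proof. by case: hp => mp _ _; apply/(measurable_restrictT _ mD). Qed.

Lemma pdf_restrict_ge0 x : 0 <= (p \_ D) x.
Proof.
by case: hp => _ p0 _; rewrite patchE; case: ifPn => // /set_mem; exact: p0.
Qed.

Lemma integral_pdf_restrict : (\int[mu]_x ((p \_ D) x)%:E = 1)%E.
Proof.
case: hp => _ _ <-; rewrite [RHS]integral_mkcond; apply: eq_integral => x _.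
by rewrite !patchE; case: ifP.
Qed.

(** [inner] is a real-valued integral, so the equality requires finiteness: the integral is at most
    the total mass 1 because [w <= 1]. *)
Lemma inner_pdfE (w : T -> R) : measurable_fun setT w ->
  (forall x, 0 <= w x <= 1) ->
  (\int[mu]_x (w x * (p \_ D) x)%:E = (inner mu D w p)%:E)%E.
Proof.
move=> mw w01; have mq := measurable_pdf_restrict.
have q0 := pdf_restrict_ge0.
have I0 : (0 <= \int[mu]_x (w x * (p \_ D) x)%:E)%E.
  apply: integral_ge0 => x _; have /andP[w0 _] := w01 x.
  by rewrite lee_fin mulr_ge0.
rewrite /inner /Rintegral [X in fine X](_ : _ =
    \int[mu]_x (w x * (p \_ D) x)%:E)%E; last first.
  rewrite integral_mkcond; apply: eq_integral => x _.
  by rewrite !patchE; case: ifP; rewrite ?mulr0.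
rewrite fineK// ge0_fin_numE// (@le_lt_trans _ _ 1%E) ?ltry//.
rewrite -integral_pdf_restrict; apply: ge0_le_integral => //.
- by move=> x _; have /andP[w0 _] := w01 x; rewrite lee_fin mulr_ge0.
- by apply/measurable_EFinP; exact: measurable_funM.
- exact/measurable_EFinP.
- by move=> x _; have /andP[_ w1] := w01 x; rewrite lee_fin ler_piMl.
Qed.

Lemma inner_pdf_ge0 (w : T -> R) : measurable_fun setT w ->
  (forall x, 0 <= w x <= 1) -> 0 <= inner mu D w p.
Proof.
move=> mw w01; rewrite -lee_fin -inner_pdfE//; apply: integral_ge0 => x _.
by have /andP[w0 _] := w01 x; rewrite lee_fin mulr_ge0 ?pdf_restrict_ge0.
Qed.

Lemma inner_pdf_compl (w : T -> R) : measurable_fun setT w ->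
  (forall x, 0 <= w x <= 1) ->
  inner mu D w p + inner mu D (fun x => 1 - w x) p = 1.
Proof.
move=> mw w01; have mw' : measurable_fun setT (fun x => 1 - w x).
  exact: measurable_funB.
have w01' x : 0 <= 1 - w x <= 1.
  by have /andP[w0 w1] := w01 x; rewrite subr_ge0 w1 gerBl w0.
have mq := measurable_pdf_restrict; have q0 := pdf_restrict_ge0.
apply: EFin_inj; rewrite EFinD -!inner_pdfE// -ge0_integralD//.
- rewrite -integral_pdf_restrict; apply: eq_integral => x _.
  by rewrite -EFinD -mulrDl addrC subrK mul1r.
- by move=> x _; have /andP[w0 _] := w01 x; rewrite lee_fin mulr_ge0.
- by apply/measurable_EFinP; exact: measurable_funM.
- by move=> x _; have /andP[w0 _] := w01' x; rewrite lee_fin mulr_ge0.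
- by apply/measurable_EFinP; exact: measurable_funM.
Qed.

End inner_pdf.

(** * Two facts on nonnegative series *)

Lemma nneseries_widen (R : realType) (u : nat -> \bar R) n :
  (forall m, 0 <= u m)%E -> (forall m, (m < n)%N -> u m = 0%E) ->
  (\sum_(0 <= m <oo) u m = \sum_(n <= m <oo) u m)%E.
Proof.
move=> u0 un; by rewrite (@nneseries_split _ _ 0 n)// add0n big_nat big1 ?add0e.
Qed.

(** The terms with [n > m] vanish, which leaves the finite binomial expansion. *)
Lemma binomial_nneseries (R : realType) (a b : R) m : 0 <= a -> 0 <= b ->
  (\sum_(0 <= n <oo) ('C(m, n)%:R * a ^+ n * b ^+ (m - n))%:E =
   ((a + b) ^+ m)%:E)%E.
Proof.
move=> a0 b0; have t0 n : (0 <= ('C(m, n)%:R * a ^+ n * b ^+ (m - n))%:E)%E.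
  by rewrite lee_fin !mulr_ge0// exprn_ge0.
rewrite (@nneseries_split _ _ 0 m.+1)// add0n.
rewrite [X in (_ + X)%E]eseries0 ?adde0; last first.
  by move=> n mn _; rewrite bin_small// !mul0r.
rewrite sumEFin big_mkord addrC exprDn; congr EFin; apply: eq_bigr => i _.
by rewrite -mulr_natr; ring.
Qed.

(** * Evaluation of the set integral term by term *)

Section fov_cardinality.
Context {R : realType} {ns nv : nat} (hn : (0 < ns + nv)%N).
Context {D : set (state R ns nv)} (mD : measurable D).
Context {rho : nat -> R} (rho0 : forall m, 0 <= rho m).
Context {p : state R ns nv -> R} (hp : is_pdf state_measure D p).
Context {S : set (euclidean R ns)} (mS : measurable S).

Let a := inner state_measure D (fov_indic S) p.
Let b := inner state_measure D (fun x => 1 - fov_indic S x) p.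

Lemma measurable_fov_indic :
  measurable_fun setT (fov_indic S : state R ns nv -> R).
Proof.
by apply: measurableT_comp; [exact: measurable_indic|exact: measurable_fst].
Qed.

Lemma fov_indic_le1 (x : state R ns nv) : 0 <= (fov_indic S x : R) <= 1.
Proof. by rewrite /fov_indic indicE; case: (_ \in _); rewrite ?lexx ?ler01. Qed.

Lemma fov_integral m n :
  (\int[power_measure state_measure m]_(t in [set t | forall i, D (tnth t i)])
     (fov_cond_card S n [fset x in tval t]%fset *
      iid_cluster_density rho p [fset x in tval t]%fset)%:E =
   (m`!%:R * rho m * ('C(m, n)%:R * a ^+ n * b ^+ (m - n)))%:E)%E.
Proof.
pose A : set (state R ns nv) := fst @^-1` S.
have mA : measurable A.
  by rewrite -[A]setTI; exact: measurable_fst.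
(* Extending [p] by 0 moves the domain restriction into the integrand: the product vanishes once an
   entry leaves [D]. *)
pose q := p \_ D.
have mq : measurable_fun setT q by exact: (measurable_pdf_restrict _ _ _ mD hp).
have q0 x : 0 <= q x by exact: (pdf_restrict_ge0 _ _ _ hp).
have AE (x : state R ns nv) : \1_A x = fov_indic S x :> R.
  by rewrite /fov_indic !indicE; congr (nat_of_bool _)%:R; apply/idP/idP; rewrite !inE.
have ia : (\int[state_measure]_x (\1_A x * q x)%:E = a%:E)%E.
  rewrite -(inner_pdfE _ _ _ mD hp _ measurable_fov_indic fov_indic_le1).
  by apply: eq_integral => x _; rewrite AE.
have ib : (\int[state_measure]_x ((1 - \1_A x) * q x)%:E = b%:E)%E.
  rewrite -(inner_pdfE _ _ _ mD hp).
  - by apply: eq_integral => x _; rewrite AE.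
  - by apply: measurable_funB => //; exact: measurable_fov_indic.
  - by move=> x; have /andP[w0 w1] := fov_indic_le1 x; rewrite subr_ge0 w1 gerBl w0.
have mrho0 : 0 <= m`!%:R * rho m by rewrite mulr_ge0.
pose g (t : m.-tuple (state R ns nv)) : R :=
  (count (mem A) t == n)%:R * \prod_(x <- t) q x.
have mg : measurable_fun setT g.
  apply: measurable_funM; first exact: measurable_count_eq.
  exact: measurable_prod_tuple.
have g0 t : 0 <= g t by rewrite mulr_ge0// prodr_ge0.
rewrite [RHS]EFinM -(integral_power_measure_count _ _ _ _ _ m n mA mq q0 ia ib).
rewrite -ge0_integralZl_EFin//; last first.
- exact/measurable_EFinP.
- by move=> t _; rewrite lee_fin; exact: g0.
(* Off the null set of tuples with repetitions, the integrand is the measurable function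
   [m! * rho m * g]; on that set only its sign is used. *)
rewrite [LHS]integral_mkcond; apply: (ge0_eq_integral_null
  (power_measure state_measure m)
  [set t : m.-tuple (state R ns nv) | ~~ uniq t]).
- by apply: measurable_not_uniq; exact: measurable_diagonal_state.
- apply: power_measure_not_uniq => [|x]; first exact: measurable_diagonal_state.
  exact: state_measure_set1.
- by apply/measurable_EFinP; exact: measurable_funM.
- move=> t; rewrite patchE; case: ifPn => // /set_mem tD; rewrite lee_fin.
  rewrite fov_cond_cardE mulr_ge0// /iid_cluster_density mulr_ge0//.
    by rewrite mulr_ge0.
  rewrite big_seq prodr_ge0// => x; rewrite inE => /tnthP[i ->].
  by case: hp => _ p0 _; exact/p0/tD.
- by move=> t; rewrite -EFinM lee_fin mulr_ge0// g0.
- move=> t /= /negP; rewrite negbK => ut; rewrite patchE.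
  case: ifPn => [/set_mem /= tD|/negP tD].
    rewrite fset_tuple_fov_density//= -EFinM; congr (_ * (_ * _))%:E.
    rewrite big_seq [RHS]big_seq; apply: eq_bigr => x /tnthP[i ->].
    by rewrite /q patchE mem_set//; exact: tD.
  rewrite -EFinM; apply/esym/eqP; rewrite eqe; apply/eqP.
  (* The restricted integrand is 0 here, so some factor of the product has to vanish too. *)
  have [i tiD] : exists i, ~ D (tnth t i).
    by apply/existsNP => tD'; apply: tD; rewrite inE.
  have -> : \prod_(x <- t) q x = 0.
    apply/eqP/negPn/negP; rewrite prodf_seq_neq0 => /allP/(_ _ (mem_tnth i t)).
    by rewrite /q patchE memNset// eqxx.
  by rewrite !mulr0.
Qed.

(** The weight [1/m!] of the set integral cancels the factorial in the cluster density. *)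
Lemma fov_card_nneseries n : fov_card D (iid_cluster_density rho p) S n =
  (\sum_(0 <= m <oo) ((rho m)%:E * ('C(m, n)%:R * a ^+ n * b ^+ (m - n))%:E))%E.
Proof.
by apply: eq_eseriesr => m _; rewrite fov_integral -!EFinM -mulrA mulKf.
Qed.

End fov_cardinality.

(** * Closed form and normalisation of the cardinality distribution *)

Theorem proposition2 (R : realType) (ns nv : nat) (hn : (0 < ns + nv)%N)
    (Xs : set (euclidean R ns)) (Xv : set (euclidean R nv))
    (mXs : measurable Xs) (mXv : measurable Xv)
    (rho : nat -> R) (hrho : is_pmf (fun m => (rho m)%:E))
    (p : state R ns nv -> R) (hp : is_pdf state_measure (Xs `*` Xv) p)
    (S : set (euclidean R ns)) (hS : is_field_of_view Xs S) :
  let XX := Xs `*` Xv in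
  let rhoS := fov_card XX (iid_cluster_density rho p) S in
  is_pmf rhoS /\
  forall n : nat,
    rhoS n = (\sum_(n <= m <oo)
      (rho m * 'C(m, n)%:R *
       inner state_measure XX (fov_indic S) p ^+ n *
       inner state_measure XX (fun x => 1 - fov_indic S x) p ^+ (m - n))%:E)%E.
Proof.
move=> XX rhoS.
have mXX : measurable XX by exact: measurableX.
have mS := measurable_field_of_view _ _ _ _ hS.
have rho0 m : 0 <= rho m by have [/(_ m)] := hrho; rewrite lee_fin.
have rhoSE := fov_card_nneseries hn mXX rho0 hp mS.
have mI := @measurable_fov_indic R ns nv S mS.
have I01 := @fov_indic_le1 R ns nv S.
have a0 := inner_pdf_ge0 _ _ _ mXX hp _ mI I01.
have ab1 := inner_pdf_compl _ _ _ mXX hp _ mI I01.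
have b0 : 0 <= inner state_measure XX (fun x => 1 - fov_indic S x) p.
  apply: (inner_pdf_ge0 _ _ _ mXX hp); first exact: measurable_funB.
  by move=> x; have /andP[w0 w1] := I01 x; rewrite subr_ge0 w1 gerBl w0.
(* The two inner products enter the rest only through nonnegativity, their sum 1 and the series
   formula. *)
move: (inner _ _ _ p) (inner _ _ (fun x => 1 - _) p) a0 b0 ab1 rhoSE.
move=> a b a0 b0 ab1 rhoSE.
have c0 m n : (0 <= (rho m)%:E * ('C(m, n)%:R * a ^+ n * b ^+ (m - n))%:E)%E.
  by rewrite -EFinM lee_fin !mulr_ge0// exprn_ge0.
split; last first.
  (* The sum may start at [n] because ['C(m, n)] vanishes for [m < n]. *)
  move=> n; rewrite /rhoS rhoSE (nneseries_widen _ _ n)//.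
    by apply: eq_eseriesr => m _; rewrite -EFinM !mulrA.
  by move=> m mn; rewrite bin_small// !mul0r mule0.
split; first by move=> n; rewrite /rhoS rhoSE; exact: nneseries_ge0.
under eq_eseriesr do rewrite /rhoS rhoSE.
(* All terms are nonnegative, so the series can be exchanged; the inner sum over [n] is then
   [rho m * (a + b) ^+ m], that is [rho m]. *)
rewrite (@nneseries_interchange _ (fun n m =>
  (rho m)%:E * ('C(m, n)%:R * a ^+ n * b ^+ (m - n))%:E)%E)//.
rewrite -[RHS](hrho.2); apply: eq_eseriesr => m _.
rewrite nneseriesZl; last first.
  by move=> n _; rewrite lee_fin !mulr_ge0// exprn_ge0.
by rewrite binomial_nneseries// ab1 expr1n mule1.
Qed.
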